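(* Let $(A,\Delta)$ be a finite $^*$-quantum hypergroup with antipode $S$, and let $(B,\Delta)$ be its dual. Then $B$ is a $^*$-algebra if the involution on $B$ is defined by $\langle a,b^*\rangle=\overline{\langle S(a)^*,b\rangle}$ for $a\in A$, $b\in B$, and $(B,\Delta)$ is again a finite $^*$-quantum hypergroup. If the left integral $\varphi$ on $A$ is positive, then so is the dual right integral $\psi$ on $B$.
   Context: All algebras are finite-dimensional, associative and unital over $\mathbb C$. A coproduct on $A$ is a linear map $\Delta:A\to A\otimes A$ with $(\Delta\otimes\iota)\Delta=(\iota\otimes\Delta)\Delta$ (not assumed multiplicative); $\iota$ is the identity map. A counit is a linear map $\varepsilon:A\to\mathbb C$ with $(\varepsilon\otimes\iota)\Delta(a)=a=(\iota\otimes\varepsilon)\Delta(a)$ for all $a$. A linear functional $\omega$ on $A$ is faithful if $\omega(ac)=0$ for all $c$ implies $a=0$, and $\omega(ac)=0$ for all $a$ implies $c=0$. A linear functional $\varphi$ on $A$ is a left integral if there is a linear map $S:A\to A$ with $S((\iota\otimes\varphi)(\Delta(a)(1\otimes c)))=(\iota\otimes\varphi)((1\otimes a)\Delta(c))$ for all $a,c\in A$. If $\varphi$ is faithful, $S$ is unique and called the antipode of $\varphi$. A finite quantum hypergroup is a pair $(A,\Delta)$ of a finite-dimensional unital algebra $A$ with a coproduct admitting a counit, such that there is a faithful left integral on $A$, $\Delta(1)=1\otimes1$, the counit is an algebra homomorphism, and the antipode $S$ of the integral is an anti-isomorphism of the algebra $A$. (The left integral is then unique up to a scalar, and the antipode is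 unique.) It is a finite $^*$-quantum hypergroup if moreover $A$ is a $^*$-algebra and $\Delta(a^* )=\Delta(a)^*$ for all $a$, with $(a\otimes a')^*=a^*\otimes a'^*$. The dual $(B,\Delta)$ is the dual space $B$ of $A$, with $\langle a,b\rangle$ the value of $b$ at $a$, and product and coproduct given by $\langle a,bb'\rangle=\langle\Delta(a),b\otimes b'\rangle$ and $\langle a\otimes a',\Delta(b)\rangle=\langle aa',b\rangle$. For a faithful left integral $\varphi$ on $A$, each $b\in B$ is $\varphi(\,\cdot\,c)$ for a unique $c\in A$, and the dual right integral $\psi$ on $B$ is defined by $\psi(b)=\varepsilon(c)$. A linear functional $\omega$ on a $^*$-algebra is positive if $\omega(x^*x)\ge 0$ for all $x$. *)

(* Defs.v *)
From HB Require Import structures.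
From mathcomp Require Import all_boot all_order all_algebra all_field.
From mathcomp Require Export reals complex.

Set Implicit Arguments.
Unset Strict Implicit.
Unset Printing Implicit Defensive.

Import GRing.Theory Num.Theory.
Local Open Scope ring_scope.

(* The tensor product U (x) V of finite-dimensional spaces is modelled by the  *)
(* coordinate matrices with respect to fixed bases of U and V. The alias hides *)
(* the matrix product, which is not the product of the algebra A (x) A.        *)
Definition tensor (K : fieldType) (U V : vectType K) : Type :=
  'M[K]_(\dim {:U}, \dim {:V}).

HB.instance Definition _ (K : fieldType) (U V : vectType K) :=
  Vector.copy (tensor U V) 'M[K]_(\dim {:U}, \dim {:V}).

Definition stdb (K : fieldType) (U : vectType K) (i : 'I_(\dim {:U})) : U :=
  (vbasis {:U})`_i.

Definition stdc (K : fieldType) (U : vectType K) (i : 'I_(\dim {:U})) : U -> K :=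
  coord (vbasis {:U}) i.

Definition tens (K : fieldType) (U V : vectType K) (u : U) (v : V) :
  tensor U V := \matrix_(i, j) (stdc i u * stdc j v).

Notation "u '\ox' v" := (tens u v)
  (at level 40, left associativity) : ring_scope.

Section Tensor.
Variable K : fieldType.
Implicit Types U V W : vectType K.

(* The extension of a bilinear map f to the tensor product: see [tliftE]. *)
Definition tlift U V W (f : U -> V -> W) (x : tensor U V) : W :=
  \sum_i \sum_j (x : 'M_(_, _)) i j *: f (stdb i) (stdb j).

Definition tmap U V U' V' (f : U -> U') (g : V -> V') (x : tensor U V) :
  tensor U' V' := tlift (fun u v => f u \ox g v) x.

Definition tassoc U V W (x : tensor (tensor U V) W) : tensor U (tensor V W) :=
  tlift (fun y w => tlift (fun u v => u \ox (v \ox w)) y) x.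

Definition tmul (A B : falgType K) (x y : tensor A B) : tensor A B :=
  tlift (fun a b => tlift (fun a' b' => (a * a') \ox (b * b')) y) x.

(* The slice maps (omega (x) iota) and (iota (x) omega). *)
Definition slicel U V (w : U -> K^o) (x : tensor U V) : V :=
  tlift (fun u v => w u *: v) x.

Definition slicer U V (w : V -> K^o) (x : tensor U V) : U :=
  tlift (fun u v => w v *: u) x.

Definition bilin U V W (f : U -> V -> W) : Prop :=
  (forall v, linear (f^~ v)) /\ (forall u, linear (f u)).

Lemma stdcP U i : linear (@stdc K U i : U -> K^o).
Proof. by move=> k u v; rewrite /stdc linearP. Qed.

HB.instance Definition _ U i :=
  GRing.isLinear.Build K U K^o *%R (@stdc K U i) (@stdcP U i).

Lemma stdb_sum U (u : U) : u = \sum_i stdc i u *: stdb i.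
Proof. by rewrite {1}(coord_vbasis (memvf u)). Qed.

Lemma stdc_stdb U (i j : 'I_(\dim {:U})) : stdc i (stdb j) = (i == j)%:R.
Proof.
by rewrite eq_sym; apply: coord_free (basis_free (vbasisP {:U})).
Qed.

Lemma tensE U V (u : U) (v : V) i j :
  (u \ox v : 'M_(_, _)) i j = stdc i u * stdc j v.
Proof. by rewrite mxE. Qed.

Lemma tlift_is_linear U V W (f : U -> V -> W) : linear (tlift f).
Proof.
move=> k x y; rewrite /tlift scaler_sumr -big_split; apply: eq_bigr => i _ /=.
rewrite scaler_sumr -big_split; apply: eq_bigr => j _ /=.
by rewrite !mxE scalerDl scalerA.
Qed.

HB.instance Definition _ U V W (f : U -> V -> W) :=
  GRing.isLinear.Build K (tensor U V) W *:%R (tlift f) (tlift_is_linear f).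

Lemma bilin_sum U V W (f : U -> V -> W) (u : U) (v : V) : bilin f ->
  f u v = \sum_i \sum_j (stdc i u * stdc j v) *: f (stdb i) (stdb j).
Proof.
move=> [fl fr].
pose Fl w := GRing.isLinear.Build _ _ _ _ (f^~ w) (fl w).
pose Fr w := GRing.isLinear.Build _ _ _ _ (f w) (fr w).
pose gl w : {linear U -> W} := HB.pack (f^~ w) (Fl w).
pose gr w : {linear V -> W} := HB.pack (f w) (Fr w).
rewrite {1}(stdb_sum u) -[LHS]/(gl v _) linear_sum; apply: eq_bigr => i _.
rewrite linearZ /= {1}(stdb_sum v) -[f _ _]/(gr (stdb i) _) linear_sum.
by rewrite scaler_sumr; apply: eq_bigr => j _; rewrite linearZ scalerA.
Qed.

Lemma tliftE U V W (f : U -> V -> W) (u : U) (v : V) :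
  bilin f -> tlift f (u \ox v) = f u v.
Proof.
move=> fP; rewrite (bilin_sum _ _ fP); apply: eq_bigr => i _.
by apply: eq_bigr => j _; rewrite tensE.
Qed.

Lemma tens_bilin U V : bilin (@tens K U V).
Proof.
split=> [v k u u'|u k v v']; apply/matrixP=> i j; rewrite !mxE linearP /=.
  by rewrite mulrDl mulrA.
by rewrite mulrDr mulrCA.
Qed.

Lemma tensDl U V (u u' : U) (v : V) : (u + u') \ox v = u \ox v + u' \ox v.
Proof. by have := (tens_bilin U V).1 v 1 u u'; rewrite !scale1r. Qed.

Lemma tensDr U V (u : U) (v v' : V) : u \ox (v + v') = u \ox v + u \ox v'.
Proof. by have := (tens_bilin U V).2 u 1 v v'; rewrite !scale1r. Qed.

Lemma tens0l U V (v : V) : (0 : U) \ox v = 0.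
Proof. by apply/matrixP=> i j; rewrite !mxE linear0 mul0r. Qed.

Lemma tens0r U V (u : U) : u \ox (0 : V) = 0.
Proof. by apply/matrixP=> i j; rewrite !mxE linear0 mulr0. Qed.

Lemma tensZl U V k (u : U) (v : V) : (k *: u) \ox v = k *: (u \ox v).
Proof. by have := (tens_bilin U V).1 v k u 0; rewrite tens0l !addr0. Qed.

Lemma tensZr U V k (u : U) (v : V) : u \ox (k *: v) = k *: (u \ox v).
Proof. by have := (tens_bilin U V).2 u k v 0; rewrite tens0r !addr0. Qed.

Lemma tensor_sum U V (x : tensor U V) :
  x = \sum_i \sum_j (x : 'M_(_, _)) i j *: (stdb i \ox stdb j).
Proof.
apply/matrixP=> i j; rewrite summxE (bigD1 i) //= summxE (bigD1 j) //=.
rewrite !mxE !stdc_stdb !eqxx !mulr1 !big1 ?addr0 //.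
  move=> k /negbTE ki; rewrite summxE big1 // => l _.
  by rewrite !mxE !stdc_stdb eq_sym ki mul0r mulr0.
by move=> l /negbTE lj; rewrite !mxE !stdc_stdb [j == l]eq_sym lj !mulr0.
Qed.

Lemma tensor_ind U V (P : tensor U V -> Prop) :
  (forall u v, P (u \ox v)) -> (forall x y, P x -> P y -> P (x + y)) ->
  forall x, P x.
Proof.
move=> Pp PD x; have P0 : P 0 by rewrite -(tens0l _ 0).
rewrite [x]tensor_sum; apply: big_ind => // i _; apply: big_ind => // j _.
by rewrite -tensZl.
Qed.

Lemma tlift_add U V W (f : U -> V -> W) (x y : tensor U V) :
  tlift f (x + y) = tlift f x + tlift f y.
Proof. exact: linearD. Qed.

Lemma tmapE U V U' V' (f : {linear U -> U'}) (g : {linear V -> V'}) u v :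
  tmap f g (u \ox v) = f u \ox g v.
Proof.
rewrite /tmap tliftE //; split=> [v' k u1 u2|u' k v1 v2].
  by rewrite linearP tensDl tensZl.
by rewrite linearP tensDr tensZr.
Qed.

Lemma tassocE U V W (u : U) (v : V) (w : W) :
  tassoc ((u \ox v) \ox w) = u \ox (v \ox w).
Proof.
have bil w' : bilin (fun (u : U) (v : V) => u \ox (v \ox w')).
  split=> [v' k u1 u2|u' k v1 v2]; first by rewrite tensDl tensZl.
  by rewrite tensDl tensDr tensZl tensZr.
rewrite /tassoc !tliftE //; split=> [w' k y1 y2|y k w1 w2].
  exact: linearP.
elim/tensor_ind: y => [u' v'|y y' IHy IHy'].
  by rewrite !tliftE // tensDr tensDr tensZr tensZr.
by rewrite !tlift_add IHy IHy' scalerDr addrACA.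
Qed.

Lemma tmulE (A B : falgType K) (a a' : A) (b b' : B) :
  tmul (a \ox b) (a' \ox b') = (a * a') \ox (b * b').
Proof.
have bil c d : bilin (fun (a' : A) (b' : B) => (c * a') \ox (d * b')).
  split=> [v k u u'|v k u u']; rewrite mulrDr -scalerAr.
    by rewrite tensDl tensZl.
  by rewrite tensDr tensZr.
rewrite /tmul !tliftE //; split=> [d k c c'|c k d d'] /=;
  rewrite !tliftE // mulrDl -scalerAl.
  by rewrite tensDl tensZl.
by rewrite tensDr tensZr.
Qed.

End Tensor.

Lemma linfun_linE (K : fieldType) (U V : vectType K) (f : U -> V) :
  linear f -> linfun f =1 f.
Proof.
move=> fP u; pose m := GRing.isLinear.Build _ _ _ _ f fP.
pose g : {linear U -> V} := HB.pack f m.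
exact: (lfunE g u).
Qed.

Section Coalgebra.
Variables (K : fieldType) (A : falgType K) (Delta : 'Hom(A, tensor A A)).

Definition coassociative : Prop :=
  forall a, tassoc (tmap Delta id (Delta a)) = tmap id Delta (Delta a).

Definition is_counit (eps : 'Hom(A, K^o)) : Prop :=
  forall a, slicel eps (Delta a) = a /\ slicer eps (Delta a) = a.

Record counital_coproduct (eps : 'Hom(A, K^o)) : Prop := CounitalCoproduct {
  coproductA : coassociative;
  counitP : is_counit eps }.

Definition faithful (w : 'Hom(A, K^o)) : Prop :=
  (forall a, (forall c, w (a * c) = 0) -> a = 0) /\
  (forall c, (forall a, w (a * c) = 0) -> c = 0).

Definition integral_antipode (phi : 'Hom(A, K^o)) (S : 'End(A)) : Prop :=
  forall a c, S (slicer phi (tmul (Delta a) (1 \ox c))) =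
              slicer phi (tmul (1 \ox a) (Delta c)).

Definition left_integral (phi : 'Hom(A, K^o)) : Prop :=
  exists S : 'End(A), integral_antipode phi S.

(* [eps] is the counit and [S] the antipode of (A, Delta); both are determined *)
(* by Delta.                                                                   *)
Record finite_qhypergroup (eps : 'Hom(A, K^o)) (S : 'End(A)) : Prop :=
  FiniteQHypergroup {
  fqh_coproduct : counital_coproduct eps;
  fqh_integral :
    exists phi : 'Hom(A, K^o), faithful phi /\ integral_antipode phi S;
  fqh_coproduct1 : Delta 1 = 1 \ox 1;
  fqh_counit1 : eps 1 = 1;
  fqh_counitM : forall a b, eps (a * b) = eps a * eps b;
  fqh_antipode_bij : bijective S;
  fqh_antipode1 : S 1 = 1;
  fqh_antipodeM : forall a b, S (a * b) = S b * S a }.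

End Coalgebra.

Section Star.
Variables (C : numClosedFieldType) (A : falgType C) (star : A -> A).

Record star_algebra : Prop := StarAlgebra {
  starD : forall a b, star (a + b) = star a + star b;
  starZ : forall (k : C) a, star (k *: a) = k^* *: star a;
  starM : forall a b, star (a * b) = star b * star a;
  starK : involutive star }.

(* The conjugate-linear map determined by a (x) a' |-> star a (x) star a'. *)
Definition tstar (x : tensor A A) : tensor A A :=
  \sum_i \sum_j ((x : 'M_(_, _)) i j)^* *: (star (stdb i) \ox star (stdb j)).

Definition positive (w : 'Hom(A, C^o)) : Prop :=
  forall x, 0 <= (w (star x * x) : C).

Record finite_star_qhypergroup (Delta : 'Hom(A, tensor A A))
    (eps : 'Hom(A, C^o)) (S : 'End(A)) : Prop := FiniteStarQHypergroup {
  fsqh_fqh :> finite_qhypergroup Delta eps S;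
  fsqh_star : star_algebra;
  fsqh_coproduct_star : forall a, Delta (star a) = tstar (Delta a) }.

Lemma tstarE : star_algebra ->
  forall a b, tstar (a \ox b) = star a \ox star b.
Proof.
move=> sP a b.
have s0 : star 0 = 0 by rewrite -(scale0r 0) (starZ sP) conjC0 !scale0r.
have starE u : star u = \sum_i (stdc i u)^* *: star (stdb i).
  rewrite {1}(stdb_sum u) (big_morph star (starD sP) s0).
  by apply: eq_bigr => i _; rewrite (starZ sP).
rewrite (starE a) (starE b).
rewrite (big_morph (@tens _ A A ^~ _) (fun a a' => tensDl a a' _) (tens0l _ _)).
apply: eq_bigr => i _; rewrite (big_morph (tens _) (tensDr _) (tens0r _ _)).
by apply: eq_bigr => j _; rewrite tensE rmorphM tensZl tensZr scalerA.
Qed.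

End Star.

Section Dual.
Variables (K : fieldType) (A : falgType K).
Variables (Delta : 'Hom(A, tensor A A)) (eps : 'Hom(A, K^o)).

(* The dual space of A; the argument only serves to make the algebra structure *)
(* dual to Delta canonical.                                                    *)
Definition dual of counital_coproduct Delta eps : Type := 'Hom(A, K^o).

Variable H : counital_coproduct Delta eps.
Local Notation B := (dual H).

HB.instance Definition _ := Vector.copy B 'Hom(A, K^o).

Definition pairing (a : A) (b : B) : K := (b : 'Hom(A, K^o)) a.

Definition tpairing (x : tensor A A) (y : tensor B B) : K :=
  tlift (fun a a' => tlift (fun b b' => pairing a b * pairing a' b' : K^o) y) x.

Definition dual_one : B := eps.

Definition dual_mul (b b' : B) : B :=
  linfun (fun a => tpairing (Delta a) (b \ox b') : K^o).

Lemma pairing_bilin : bilin (pairing : A -> B -> K^o).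
Proof.
split=> [b k a a'|a k b b']; rewrite /pairing; first by rewrite linearP.
by rewrite add_lfunE scale_lfunE.
Qed.

Lemma pairing_ext (b b' : B) :
  (forall a, pairing a b = pairing a b') -> b = b'.
Proof. by move=> e; apply/lfunP. Qed.

Lemma pairingDl a a' b : pairing (a + a') b = pairing a b + pairing a' b.
Proof. by rewrite /pairing linearD. Qed.

Lemma pairingDr a b b' : pairing a (b + b') = pairing a b + pairing a b'.
Proof. by rewrite /pairing add_lfunE. Qed.

Lemma pairingZl k a b : pairing (k *: a) b = k * pairing a b.
Proof. by rewrite /pairing linearZ. Qed.

Lemma pairingZr k a b : pairing a (k *: b) = k * pairing a b.
Proof. by rewrite /pairing scale_lfunE. Qed.

Definition pairing_simp := (pairingDl, pairingDr, pairingZl, pairingZr).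

Lemma tpairing_linear y : linear ((tpairing^~ y) : tensor A A -> K^o).
Proof. by move=> k x x'; rewrite /tpairing linearP. Qed.

Lemma tpairingDl x x' y : tpairing (x + x') y = tpairing x y + tpairing x' y.
Proof. by rewrite /tpairing tlift_add. Qed.

Lemma tpairing_tensl a a' (y : tensor B B) : tpairing (a \ox a') y =
  tlift (fun b b' => pairing a b * pairing a' b' : K^o) y.
Proof.
rewrite /tpairing tliftE //.
split=> [c' k c c2|c k c' c2'] /=.
  rewrite /tlift scaler_sumr -big_split; apply: eq_bigr => i _ /=.
  rewrite scaler_sumr -big_split; apply: eq_bigr => j _ /=.
  rewrite !pairing_simp mulrDl scalerDr -mulrA; congr (_ + _).
  exact: mulrCA.
rewrite /tlift scaler_sumr -big_split; apply: eq_bigr => i _ /=.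
rewrite scaler_sumr -big_split; apply: eq_bigr => j _ /=.
rewrite !pairing_simp mulrDr scalerDr mulrCA; congr (_ + _).
exact: mulrCA.
Qed.

Lemma tpairingE a a' b b' :
  tpairing (a \ox a') (b \ox b') = pairing a b * pairing a' b'.
Proof.
rewrite tpairing_tensl tliftE //.
split=> [d' k d d2|d k d' d2']; rewrite !pairing_simp /=.
  by rewrite mulrDl -mulrA.
by rewrite mulrDr mulrCA.
Qed.

Lemma pairing_mul a b b' :
  pairing a (dual_mul b b') = tpairing (Delta a) (b \ox b').
Proof.
rewrite /pairing linfun_linE // => k c c'.
by rewrite linearP tpairing_linear.
Qed.

Lemma dual_mulA : associative dual_mul.
Proof.
move=> b b' b''.
pose F (z : tensor A (tensor A A)) : K^o :=
  tlift (fun c t => pairing c b * tpairing t (b' \ox b'') : K^o) z.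
have FE c t : F (c \ox t) = pairing c b * tpairing t (b' \ox b'').
  rewrite /F tliftE //; split=> [t' k c1 c2|c' k t1 t2].
    by rewrite !pairing_simp mulrDl -mulrA.
  by rewrite tpairing_linear mulrDr mulrCA.
have FD z z' : F (z + z') = F z + F z' by rewrite /F tlift_add.
have L x : tpairing x (b \ox dual_mul b' b'') = F (tmap id Delta x).
  elim/tensor_ind: x => [u v|x x' IH IH'].
    by rewrite tpairingE pairing_mul (tmapE idfun Delta) FE.
  by rewrite tpairingDl IH IH' /tmap tlift_add FD.
have R x : tpairing x (dual_mul b b' \ox b'') = F (tassoc (tmap Delta id x)).
  elim/tensor_ind: x => [u v|x x' IH IH'].
    rewrite tpairingE pairing_mul (tmapE Delta idfun) /=.
    elim/tensor_ind: (Delta u) => [p q|y y' IH IH'].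
      by rewrite tassocE FE !tpairingE mulrA.
    by rewrite tpairingDl mulrDl IH IH' tensDl /tassoc tlift_add FD.
  by rewrite tpairingDl IH IH' /tmap tlift_add /tassoc tlift_add FD.
by apply: pairing_ext => a; rewrite !pairing_mul L R (coproductA H).
Qed.

Lemma dual_mul1l : left_id dual_one dual_mul.
Proof.
move=> b; apply: pairing_ext => a; rewrite pairing_mul.
rewrite -[in RHS](counitP H a).1.
elim/tensor_ind: (Delta a) => [u v|x x' IH IH'].
  rewrite tpairingE /slicel tliftE ?pairing_simp //.
  split=> [w k u1 u2|w k u1 u2]; first by rewrite linearP scalerDl scalerA.
  by rewrite scalerDr !scalerA mulrC.
by rewrite tpairingDl IH IH' /slicel tlift_add pairing_simp.
Qed.

Lemma dual_mul1r : right_id dual_one dual_mul.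
Proof.
move=> b; apply: pairing_ext => a; rewrite pairing_mul.
rewrite -[in RHS](counitP H a).2.
elim/tensor_ind: (Delta a) => [u v|x x' IH IH'].
  rewrite tpairingE /slicer tliftE ?pairing_simp 1?mulrC //.
  split=> [w k u1 u2|w k u1 u2]; last by rewrite linearP scalerDl scalerA.
  by rewrite scalerDr !scalerA mulrC.
by rewrite tpairingDl IH IH' /slicer tlift_add pairing_simp.
Qed.

Lemma dual_mulDl : left_distributive dual_mul +%R.
Proof.
move=> b b' b''; apply: pairing_ext => a; rewrite pairingDr !pairing_mul.
elim/tensor_ind: (Delta a) => [u v|x x' IH IH'].
  by rewrite !tpairingE pairingDr mulrDl.
by rewrite !tpairingDl IH IH' addrACA.
Qed.

Lemma dual_mulDr : right_distributive dual_mul +%R.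
Proof.
move=> b b' b''; apply: pairing_ext => a; rewrite pairingDr !pairing_mul.
elim/tensor_ind: (Delta a) => [u v|x x' IH IH'].
  by rewrite !tpairingE pairingDr mulrDr.
by rewrite !tpairingDl IH IH' addrACA.
Qed.

Lemma dual_oner_neq0 : dual_one != 0.
Proof.
apply/eqP=> e0; have := (counitP H 1).1; apply/eqP.
rewrite eq_sym /slicel /tlift big1 ?oner_eq0 // => i _; rewrite big1 // => j _.
have ->: eps (stdb i) = pairing (stdb i) dual_one by [].
by rewrite e0 /pairing zero_lfunE scale0r scaler0.
Qed.

HB.instance Definition _ := GRing.Zmodule_isNzRing.Build B
  dual_mulA dual_mul1l dual_mul1r dual_mulDl dual_mulDr dual_oner_neq0.

Lemma dual_scalerAl (k : K) (b b' : B) : k *: (b * b') = (k *: b) * b'.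
Proof.
apply: pairing_ext => a; rewrite pairingZr !pairing_mul.
elim/tensor_ind: (Delta a) => [u v|x x' IH IH'].
  by rewrite !tpairingE pairingZr mulrA.
by rewrite !tpairingDl -IH -IH' mulrDr.
Qed.

HB.instance Definition _ := GRing.Lmodule_isLalgebra.Build K B dual_scalerAl.

Lemma dual_scalerAr (k : K) (b b' : B) : k *: (b * b') = b * (k *: b').
Proof.
apply: pairing_ext => a; rewrite pairingZr !pairing_mul.
elim/tensor_ind: (Delta a) => [u v|x x' IH IH'].
  by rewrite !tpairingE pairingZr mulrCA.
by rewrite !tpairingDl -IH -IH' mulrDr.
Qed.

HB.instance Definition _ := GRing.Lalgebra_isAlgebra.Build K B dual_scalerAr.
HB.instance Definition _ := Algebra_isFalgebra.Build K B.

Lemma pairingM a (b b' : B) :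
  pairing a (b * b') = tpairing (Delta a) (b \ox b').
Proof. exact: pairing_mul. Qed.

Lemma pairing1 a : pairing a 1 = eps a.
Proof. by []. Qed.

(* Written with a basis of A and its dual basis; the defining property is      *)
(* [dual_coproductE].                                                          *)
Definition dual_coproduct : 'Hom(B, tensor B B) :=
  linfun (fun b : B => \sum_i \sum_j pairing (stdb i * stdb j) b *:
    ((linfun (@stdc K A i : A -> K^o) : B) \ox
     (linfun (@stdc K A j : A -> K^o) : B))).

Lemma dual_coproductE a a' b :
  tpairing (a \ox a') (dual_coproduct b) = pairing (a * a') b.
Proof.
have stdcE (i : 'I_(\dim {:A})) c :
    pairing c (linfun (@stdc K A i : A -> K^o)) = stdc i c.
  by rewrite /pairing linfun_linE //; apply: stdcP.
rewrite /dual_coproduct linfun_linE; last first.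
  move=> k b1 b2; rewrite scaler_sumr -big_split; apply: eq_bigr => i _ /=.
  rewrite scaler_sumr -big_split; apply: eq_bigr => j _ /=.
  by rewrite !pairing_simp scalerDl scalerA.
have tD : {morph (tpairing (a \ox a')) : y y' / y + y'}.
  by move=> y y'; rewrite !tpairing_tensl tlift_add.
have t0 : tpairing (a \ox a') 0 = 0.
  by rewrite tpairing_tensl /tlift !big1 // => i _; rewrite big1 // => j _;
     rewrite mxE scale0r.
rewrite (big_morph _ tD t0).
rewrite {2}(stdb_sum a) {2}(stdb_sum a') mulr_suml.
rewrite /pairing linear_sum; apply: eq_bigr => i _.
rewrite (big_morph _ tD t0) mulr_sumr linear_sum; apply: eq_bigr => j _.
rewrite -tensZl tpairingE pairingZr !stdcE -scalerAl -scalerAr !linearZ.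
by rewrite /pairing /= -mulrA mulrC -mulrA.
Qed.

(* [lmul_form phi c] is the functional phi(- c).                               *)
Definition lmul_form (phi : 'Hom(A, K^o)) : 'Hom(A, B) :=
  linfun (fun c : A => linfun (fun a => phi (a * c)) : B).

Lemma lmul_formE phi a c : pairing a (lmul_form phi c) = phi (a * c).
Proof.
rewrite /pairing /lmul_form linfun_linE => [|k c1 c2].
  by rewrite linfun_linE // => k a1 a2; rewrite mulrDl -scalerAl linearP.
apply/lfunP => x; rewrite add_lfunE scale_lfunE.
have lin c' : linear (fun a => phi (a * c')).
  by move=> k' a1 a2; rewrite mulrDl -scalerAl linearP.
by rewrite !linfun_linE // mulrDr -scalerAr linearP.
Qed.

(* The functional phi(- c) |-> eps c: [lmul_form phi] is invertible when phi   *)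
(* is faithful, and [_^-1] is its inverse; see [dual_integralE].               *)
Definition dual_integral (phi : 'Hom(A, K^o)) : 'Hom(B, K^o) :=
  (eps \o (lmul_form phi)^-1)%VF.

Lemma lmul_form_inj phi : faithful phi -> lker (lmul_form phi) == 0%VS.
Proof.
move=> [_ fr]; apply/lker0P=> c1 c2 e; apply/eqP; rewrite -subr_eq0.
apply/eqP/fr => a; rewrite mulrBr linearB /=; apply/eqP; rewrite subr_eq0.
by apply/eqP; have := congr1 (pairing a) e; rewrite !lmul_formE.
Qed.

Lemma dual_integralE phi c :
  faithful phi -> dual_integral phi (lmul_form phi c) = eps c.
Proof.
by move=> fP; rewrite comp_lfunE lker0_lfunK //; apply: lmul_form_inj.
Qed.

Lemma lmul_form_surj phi b : faithful phi -> exists c, b = lmul_form phi c.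
Proof.
move=> /lmul_form_inj k0.
have : b \in limg (lmul_form phi).
  suff -> : limg (lmul_form phi) = fullv by rewrite memvf.
  apply/eqP; rewrite eqEdim subvf /= limg_dim_eq ?(eqP k0) ?capv0 //.
  have e : dim (B : vectType K) = (dim A * 1)%N by reflexivity.
  by rewrite !dimvf e muln1.
by case/memv_imgP=> c _ ->; exists c.
Qed.

End Dual.

Section DualStar.
Variables (C : numClosedFieldType) (A : falgType C).
Variables (Delta : 'Hom(A, tensor A A)) (eps : 'Hom(A, C^o)).
Variable H : counital_coproduct Delta eps.

(* [linfun] applied to a map that is linear when star is conjugate-linear; see *)
(* [dual_starE].                                                               *)
Definition dual_star (star : A -> A) (S : 'End(A)) (b : dual H) : dual H :=
  linfun (fun a => (pairing (star (S a)) b)^* : C^o).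

Lemma dual_starE (star : A -> A) (S : 'End(A)) a b : star_algebra star ->
  pairing a (dual_star star S b) = (pairing (star (S a)) b)^*.
Proof.
move=> sP; rewrite {1}/pairing linfun_linE // => k a1 a2.
rewrite linearP (starD sP) (starZ sP) pairingDl pairingZl.
by rewrite rmorphD rmorphM; congr (_ + _); rewrite /= conjCK.
Qed.

End DualStar.

(* Main.v *)
(* Write [act b a] for the slice (b (x) iota)Delta(a). It is an                *)
(* anti-representation of the dual algebra B, and it is faithful because       *)
(* eps (act b a) = <a, b>. The relation defining the antipode says that        *)
(* act (b \o S) is the adjoint of act b with respect to the integral phi.      *)
(* Taking adjoints of products shows that the transpose of S is a unital       *)
(* anti-automorphism of B, and taking adjoints in phi(- d) shows that          *)
(* invariant functionals are proportional to phi. As a |-> (phi(a^* ))^* is    *)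
(* also invariant, the involution of A exchanges act b with its adjoint in a   *)
(* way that forces S(S(a)^* )^* = a, which makes the involution of B           *)
(* involutive. The left integral on B is phi(c -) |-> eps(c), and for          *)
(* b = phi(- c) adjointness gives psi(b^* b) = (phi(c^* c))^*.                 *)
Require Import Defs.
From mathcomp Require Import all_boot all_order all_algebra all_field.
From mathcomp Require Import reals complex ring.

Import Order.TTheory GRing.Theory Num.Theory.
Local Open Scope ring_scope.

Set Implicit Arguments.
Unset Strict Implicit.

(** Everything is read off from one relation, [integral_adjoint]: for the bilinear form phi(a c),
    the adjoint of [act b] is [act (transpose S b)]. Faithfulness of phi turns it into the antipode
    of B ([transposeM], [transpose_bij]) and into an explicit integral on B ([dual_left_integralM]),
    whence [dual_qhypergroup]. The involutions of A and B are linked by [dual_star_transpose], and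
    the identity [transpose_conj_formK] makes that of B involutive. Positivity follows from
    [dual_integralM] once phi is known to have antipode S, which rests on [faithful_positive1]. *)

Section Slices.
Variable K : fieldType.
Implicit Types U V : vectType K.

(** * Slices of tensors and families of functionals that separate them *)

Lemma slicelD U V (w : U -> K^o) (x y : tensor U V) :
  slicel w (x + y) = slicel w x + slicel w y.
Proof. exact: tlift_add. Qed.

Lemma slicerD U V (w : V -> K^o) (x y : tensor U V) :
  slicer w (x + y) = slicer w x + slicer w y.
Proof. exact: tlift_add. Qed.

Lemma slicelE U V (w : {linear U -> K^o}) (u : U) (v : V) :
  slicel w (u \ox v) = w u *: v.
Proof.
rewrite /slicel tliftE //; split=> [v' k u1 u2|u' k v1 v2].
  by rewrite linearP scalerDl scalerA.
by rewrite scalerDr !scalerA mulrC.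
Qed.

Lemma slicerE U V (w : {linear V -> K^o}) (u : U) (v : V) :
  slicer w (u \ox v) = w v *: u.
Proof.
rewrite /slicer tliftE //; split=> [v' k u1 u2|u' k v1 v2].
  by rewrite scalerDr !scalerA mulrC.
by rewrite linearP scalerDl scalerA.
Qed.

Lemma slicel_slicer U V (f : {linear U -> K^o}) (g : {linear V -> K^o})
    (x : tensor U V) : g (slicel f x) = f (slicer g x).
Proof.
elim/tensor_ind: x => [u v|x y IHx IHy].
  by rewrite slicelE slicerE !linearZ; apply: mulrC.
by rewrite slicelD slicerD !linearD IHx IHy.
Qed.

Lemma stdc_eq U (u v : U) : (forall i, stdc i u = stdc i v) -> u = v.
Proof.
by move=> e; rewrite [u]stdb_sum [v]stdb_sum; apply: eq_bigr => i _; rewrite e.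
Qed.

Lemma tensor_slicer U V (x : tensor U V) :
  x = \sum_j slicer (@stdc K V j) x \ox stdb j.
Proof.
elim/tensor_ind: x => [u v|x y IHx IHy].
  rewrite {1}(stdb_sum v) (big_morph (tens _) (tensDr _) (tens0r _ _)).
  by apply: eq_bigr => j _; rewrite slicerE tensZl tensZr.
rewrite {1}IHx {1}IHy -big_split; apply: eq_bigr => j _.
by rewrite slicerD tensDl.
Qed.

(** A tensor is determined by its slices along a basis of V ([tensor_slicer]), and [slicel_slicer]
    lets the two families be applied in either order. *)
Lemma tensor_sep U V (I J : Type) (F : I -> {linear U -> K^o})
    (G : J -> {linear V -> K^o}) (x y : tensor U V) :
  (forall u u', (forall i, F i u = F i u') -> u = u') ->
  (forall v v', (forall j, G j v = G j v') -> v = v') ->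
  (forall i j, G j (slicel (F i) x) = G j (slicel (F i) y)) -> x = y.
Proof.
move=> sepF sepG e; rewrite [x]tensor_slicer [y]tensor_slicer.
apply: eq_bigr => j _; congr (_ \ox _); apply: sepF => i.
rewrite -(slicel_slicer (F i) (@stdc K V j)) -slicel_slicer.
by have -> : slicel (F i) x = slicel (F i) y by apply: sepG.
Qed.

Lemma hom_sep U (u v : U) : (forall f : 'Hom(U, K^o), f u = f v) -> u = v.
Proof.
move=> e; apply: stdc_eq => i.
by rewrite -!(linfun_linE (@stdcP K U i)); apply: e.
Qed.

Lemma tmulDl (A B : falgType K) (x y z : tensor A B) :
  tmul (x + y) z = tmul x z + tmul y z.
Proof. exact: tlift_add. Qed.

Lemma tmulDr (A B : falgType K) (x y z : tensor A B) :
  tmul z (x + y) = tmul z x + tmul z y.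
Proof.
have E t : tmul z t = \sum_i \sum_j (z : 'M_(_, _)) i j *:
  tlift (fun a b => (stdb i * a) \ox (stdb j * b)) t by [].
rewrite !E -big_split; apply: eq_bigr => i _; rewrite -big_split.
apply: eq_bigr => j _ /=; rewrite -scalerDr; congr (_ *: _).
exact: tlift_add.
Qed.

Lemma slicer_tmulr (A : falgType K) (f phi : 'Hom(A, K^o))
    (x : tensor A A) c :
  f (slicer phi (tmul x (1 \ox c))) = phi (slicel f x * c).
Proof.
elim/tensor_ind: x => [u v|x y IHx IHy].
  by rewrite tmulE mulr1 slicerE slicelE -scalerAl !linearZ; apply: mulrC.
by rewrite tmulDl slicerD slicelD mulrDl !linearD /= IHx IHy.
Qed.

Lemma slicer_tmull (A : falgType K) (f phi : 'Hom(A, K^o))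
    (x : tensor A A) a :
  f (slicer phi (tmul (1 \ox a) x)) = phi (a * slicel f x).
Proof.
elim/tensor_ind: x => [u v|x y IHx IHy].
  by rewrite tmulE mul1r slicerE slicelE -scalerAr !linearZ; apply: mulrC.
by rewrite tmulDr slicerD slicelD mulrDr !linearD /= IHx IHy.
Qed.

(* [slicel f (Delta a)] is the action of the functional f on a; the antipode *)
(* relation says that f \o S acts as the adjoint of f with respect to phi.   *)
Lemma integral_antipodeE (A : falgType K) (Delta : 'Hom(A, tensor A A))
    (phi : 'Hom(A, K^o)) (S : 'End(A)) :
  integral_antipode Delta phi S <->
  forall (f : 'Hom(A, K^o)) a c,
    phi (slicel (f \o S)%VF (Delta a) * c) = phi (a * slicel f (Delta c)).
Proof.
split=> [iS f a c|adj a c].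
  by rewrite -slicer_tmulr -slicer_tmull comp_lfunE iS.
by apply: hom_sep => f; rewrite slicer_tmull -adj -slicer_tmulr comp_lfunE.
Qed.

End Slices.

(** * The action of the dual algebra on A and its adjoints under an integral *)

Section DualAlgebra.
Variables (K : fieldType) (A : falgType K).
Variables (Delta : 'Hom(A, tensor A A)) (eps : 'Hom(A, K^o)).
Variable H : counital_coproduct Delta eps.
Local Notation B := (dual H).

Definition act (b : B) (a : A) : A := slicel (b : 'Hom(A, K^o)) (Delta a).

Lemma pairing_sep (a a' : A) :
  (forall b : B, pairing a b = pairing a' b) -> a = a'.
Proof. exact: hom_sep. Qed.

Lemma tpairing_slicel (x : tensor A A) (b b' : B) :
  tpairing x (b \ox b') = pairing (slicel (b : 'Hom(A, K^o)) x) b'.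
Proof.
elim/tensor_ind: x => [u v|x y IHx IHy].
  by rewrite tpairingE slicelE pairingZl.
by rewrite tpairingDl slicelD pairingDl IHx IHy.
Qed.

Lemma pairing_act a (b b' : B) : pairing (act b a) b' = pairing a (b * b').
Proof. by rewrite pairingM tpairing_slicel. Qed.

Lemma act1 a : act 1 a = a.
Proof. by apply: pairing_sep => b; rewrite pairing_act mul1r. Qed.

Lemma actM (b b' : B) a : act (b * b') a = act b' (act b a).
Proof. by apply: pairing_sep => b2; rewrite !pairing_act mulrA. Qed.

Lemma eps_act (b : B) a : eps (act b a) = pairing a b.
Proof. by rewrite -[eps _]/(pairing (act b a) (1 : B)) pairing_act mulr1. Qed.

Lemma act_inj (b b' : B) : (forall a, act b a = act b' a) -> b = b'.
Proof. by move=> e; apply: pairing_ext => a; rewrite -!eps_act e. Qed.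

Definition transpose (S : 'End(A)) : 'End(B) :=
  linfun (fun b : B => (b \o S)%VF : B).

Lemma transposeE S (b : B) : transpose S b = (b \o S)%VF.
Proof.
rewrite linfun_linE // => k b1 b2; apply: pairing_ext => a.
by rewrite pairingDr pairingZr /pairing !comp_lfunE -/(pairing _ _)
  pairingDr pairingZr.
Qed.

Lemma pairing_transpose S a (b : B) :
  pairing a (transpose S b) = pairing (S a) b.
Proof. by rewrite transposeE /pairing comp_lfunE. Qed.

Definition left_invariant (phi : 'Hom(A, K^o)) : Prop :=
  forall (b : B) a, phi (act b a) = pairing 1 b * phi a.

Section Integral.
Variables (phi : 'Hom(A, K^o)) (S : 'End(A)).
Hypotheses (phiF : faithful phi) (phiS : integral_antipode Delta phi S).

Lemma integral_adjoint (b : B) a c :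
  phi (act (transpose S b) a * c) = phi (a * act b c).
Proof. by rewrite transposeE; apply: (integral_antipodeE _ _ _).1. Qed.

Lemma faithful_injl a a' : (forall c, phi (a * c) = phi (a' * c)) -> a = a'.
Proof.
move=> e; apply/eqP; rewrite -subr_eq0; apply/eqP/phiF.1 => c.
by rewrite mulrBl linearB /= e subrr.
Qed.

Lemma faithful_injr c c' : (forall a, phi (a * c) = phi (a * c')) -> c = c'.
Proof.
move=> e; apply/eqP; rewrite -subr_eq0; apply/eqP/phiF.2 => a.
by rewrite mulrBr linearB /= e subrr.
Qed.

Lemma transpose1 : transpose S 1 = 1.
Proof.
apply: act_inj => a; apply: faithful_injl => c.
by rewrite integral_adjoint !act1.
Qed.

(* The adjoint of [act (b * b') = act b' \o act b] is taken in two ways. *)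
Lemma transposeM (b b' : B) :
  transpose S (b * b') = transpose S b' * transpose S b.
Proof.
apply: act_inj => a; apply: faithful_injl => c.
by rewrite integral_adjoint !actM !integral_adjoint.
Qed.

Lemma transpose_inj : injective (transpose S).
Proof.
move=> b b' e; apply: act_inj => c; apply: faithful_injr => a.
by rewrite -!integral_adjoint e.
Qed.

Lemma transpose_bij : bijective (transpose S).
Proof.
have k0 : lker (transpose S) == 0%VS by apply/lker0P/transpose_inj.
by exists (transpose S)^-1%VF; [apply: lker0_lfunK | apply: lker0_lfunVK].
Qed.

Hypothesis Delta1 : Delta 1 = 1 \ox 1.

Lemma act_one (b : B) : act b 1 = pairing 1 b *: 1.
Proof. by rewrite /act Delta1 slicelE. Qed.

Lemma integral_antipode1 : phi 1 != 0 -> S 1 = 1.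
Proof.
move=> phi1; have := phiS 1 1; rewrite Delta1 tmulE !mulr1 slicerE linearZ.
by move/(scalerI phi1).
Qed.

(** Every functional is a [transpose S b], so adjointness moves it onto 1, where [act_one] turns it
    into a scalar; [S 1 = 1] identifies that scalar. *)
Lemma integral_invariant : S 1 = 1 -> left_invariant phi.
Proof.
move=> S1 b a; have [T _ TK] := transpose_bij.
rewrite -(TK b) -[act _ a]mulr1 integral_adjoint act_one -scalerAr mulr1.
by rewrite linearZ pairing_transpose S1.
Qed.

(* Writing omega as phi(- d), adjointness turns invariance of omega into *)
(* Delta d = 1 (x) d, so that d is a multiple of 1.                      *)
Lemma invariant_unique (omega : 'Hom(A, K^o)) : S 1 = 1 ->
  left_invariant omega -> exists k : K, forall a, omega a = k * phi a.
Proof.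
move=> S1 omegaI; have [d omegaE] := lmul_form_surj (omega : B) phiF.
have {}omegaE a : omega a = phi (a * d).
  by rewrite -(lmul_formE H) -omegaE.
have actd (b : B) : act b d = pairing 1 b *: d.
  apply: faithful_injr => a.
  rewrite -integral_adjoint -omegaE omegaI pairing_transpose S1.
  by rewrite -scalerAr linearZ omegaE.
have dE : d = eps d *: 1.
  apply: pairing_sep => b; rewrite -eps_act actd linearZ pairingZl.
  exact: mulrC.
by exists (eps d) => a; rewrite omegaE dE -scalerAr mulr1 linearZ /= -dE.
Qed.

(** * Integrals on the dual *)

Definition rmul_form : 'Hom(A, B) :=
  linfun (fun c : A => linfun (fun a => phi (c * a)) : B).

Lemma rmul_formE a c : pairing a (rmul_form c) = phi (c * a).
Proof.
have lin c' : linear (fun a => phi (c' * a)).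
  by move=> k a1 a2; rewrite mulrDr -scalerAr linearP.
rewrite /pairing /rmul_form linfun_linE => [|k c1 c2].
  by rewrite linfun_linE.
apply/lfunP => x; rewrite add_lfunE scale_lfunE.
by rewrite !linfun_linE // mulrDl -scalerAl linearP.
Qed.

Lemma rmul_form_inj : lker rmul_form == 0%VS.
Proof.
apply/lker0P=> c1 c2 e; apply: faithful_injl => a.
by rewrite -!rmul_formE e.
Qed.

Lemma rmul_form_surj (b : B) : exists c, b = rmul_form c.
Proof.
have : b \in limg rmul_form.
  suff -> : limg rmul_form = fullv by rewrite memvf.
  apply/eqP; rewrite eqEdim subvf /= limg_dim_eq ?(eqP rmul_form_inj) ?capv0 //.
  have e : dim (B : vectType K) = (dim A * 1)%N by reflexivity.
  by rewrite !dimvf e muln1.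
by case/memv_imgP=> c _ ->; exists c.
Qed.

(** The functional phi(c -) |-> eps c, well defined by [rmul_form_inj] when phi is faithful. *)
Definition dual_left_integral : 'Hom(B, K^o) := (eps \o rmul_form^-1)%VF.

Lemma mul_rmul_form (b : B) c :
  b * rmul_form c = rmul_form (act (transpose S b) c).
Proof.
apply: pairing_ext => a.
by rewrite -pairing_act !rmul_formE integral_adjoint.
Qed.

(** By adjointness the functionals phi(c -) absorb left factors ([mul_rmul_form]). Both the
    faithfulness of the integral on B and its antipode relation come from this formula. *)
Lemma dual_left_integralM (b : B) c :
  dual_left_integral (b * rmul_form c) = pairing (S c) b.
Proof.
rewrite mul_rmul_form comp_lfunE lker0_lfunK ?rmul_form_inj //.
by rewrite eps_act pairing_transpose.
Qed.

Lemma mul_lmul_form (b : B) c :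
  transpose S b * lmul_form H phi c = lmul_form H phi (act b c).
Proof.
apply: pairing_ext => a.
by rewrite -pairing_act !lmul_formE integral_adjoint.
Qed.

Lemma dual_integralM (b : B) c :
  dual_integral H phi (transpose S b * lmul_form H phi c) = pairing c b.
Proof. by rewrite mul_lmul_form dual_integralE // eps_act. Qed.

End Integral.

End DualAlgebra.

(** * The coproduct, counit and antipode of the dual *)

Section DualCoalgebra.
Variables (K : fieldType) (A : falgType K).
Variables (Delta : 'Hom(A, tensor A A)) (eps : 'Hom(A, K^o)).
Variable H : counital_coproduct Delta eps.
Local Notation B := (dual H).
Local Notation DeltaB := (dual_coproduct H).

Definition ev (a : A) : 'Hom(B, K^o) := linfun (pairing a : B -> K^o).

Lemma evE a (b : B) : ev a b = pairing a b.
Proof. by rewrite linfun_linE //; apply: (pairing_bilin H).2. Qed.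

Lemma ev_surj (f : 'Hom(B, K^o)) : exists a, f = ev a.
Proof.
pose d i : B := linfun (@stdc K A i : A -> K^o).
(* Reflexivity in finite dimension: the coordinates of the element are the values of f on the dual
   basis. *)
exists (\sum_i f (d i) *: stdb i); apply/lfunP => b; rewrite evE.
have {1}-> : b = \sum_i pairing (stdb i) b *: d i.
  apply: pairing_ext => a.
  rewrite /pairing sum_lfunE {1}[a]stdb_sum linear_sum; apply: eq_bigr => i _.
  rewrite scale_lfunE linearZ (linfun_linE (@stdcP K A i)); apply: mulrC.
rewrite /pairing !linear_sum; apply: eq_bigr => i _.
by rewrite !linearZ; apply: mulrC.
Qed.

Lemma ev_sep (b b' : B) : (forall a, ev a b = ev a b') -> b = b'.
Proof. by move=> e; apply: pairing_ext => a; rewrite -!evE. Qed.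

Lemma tpairing_ev a a' (y : tensor B B) :
  tpairing (a \ox a') y = ev a' (slicel (ev a) y).
Proof.
elim/tensor_ind: y => [b b'|x y IHx IHy].
  by rewrite tpairingE slicelE linearZ /= !evE.
by rewrite tpairing_tensl tlift_add slicelD linearD -!tpairing_tensl IHx IHy.
Qed.

Lemma tpairing_ext (x y : tensor B B) :
  (forall a a', tpairing (a \ox a') x = tpairing (a \ox a') y) -> x = y.
Proof.
move=> e; apply: (tensor_sep ev_sep ev_sep) => a a'.
by have := e a a'; rewrite !tpairing_ev.
Qed.

Lemma tpairingDr a a' (x y : tensor B B) :
  tpairing (a \ox a') (x + y) = tpairing (a \ox a') x + tpairing (a \ox a') y.
Proof. by rewrite !tpairing_ev slicelD linearD. Qed.

Lemma slicel_dual_coproduct a (b : B) a' :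
  pairing a' (slicel (ev a) (DeltaB b)) = pairing (a * a') b.
Proof. by rewrite -dual_coproductE tpairing_ev evE. Qed.

Lemma dual_coassociative : coassociative DeltaB.
Proof.
move=> b.
pose ev2 (p : A * A) : 'Hom(tensor B B, K^o) :=
  linfun (fun y => tpairing (p.1 \ox p.2) y : K^o).
have ev2E p y : ev2 p y = tpairing (p.1 \ox p.2) y.
  by rewrite linfun_linE // => k x x'; rewrite !tpairing_tensl linearP.
have ev2_sep y y' : (forall p, ev2 p y = ev2 p y') -> y = y'.
  by move=> e; apply: tpairing_ext => a a'; have := e (a, a'); rewrite !ev2E.
apply: (tensor_sep ev_sep ev2_sep) => a [a' a''].
(* Tested against a, a', a'', the two sides of coassociativity become the two bracketings of the
   product a a' a''. *)
have L x : ev2 (a', a'') (slicel (ev a) (tassoc (tmap DeltaB id x))) =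
    tpairing ((a * a') \ox a'') x.
  elim/tensor_ind: x => [u v|x y IHx IHy].
    rewrite (tmapE DeltaB idfun) tpairingE -dual_coproductE /=.
    elim/tensor_ind: (DeltaB u) => [p q|x y IHx IHy].
      by rewrite tassocE slicelE linearZ /= ev2E !tpairingE evE; apply: mulrA.
    rewrite tensDl /tassoc tlift_add slicelD linearD /= IHx IHy.
    by rewrite tpairingDr mulrDl.
  rewrite /tmap tlift_add /tassoc tlift_add slicelD linearD /= IHx IHy.
  by rewrite tpairingDr.
have R x : ev2 (a', a'') (slicel (ev a) (tmap id DeltaB x)) =
    tpairing (a \ox (a' * a'')) x.
  elim/tensor_ind: x => [u v|x y IHx IHy].
    rewrite (tmapE idfun DeltaB) tpairingE -dual_coproductE /=.
    by rewrite slicelE linearZ /= ev2E evE.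
  by rewrite /tmap tlift_add slicelD linearD /= IHx IHy tpairingDr.
apply: etrans (L _) (etrans _ (esym (R _))).
by rewrite !dual_coproductE mulrA.
Qed.

Lemma dual_counit : is_counit DeltaB (ev 1).
Proof.
move=> b; split; apply: pairing_ext => a.
  by rewrite slicel_dual_coproduct mul1r.
by rewrite -evE -slicel_slicer /= evE slicel_dual_coproduct mulr1.
Qed.

Variables (phi : 'Hom(A, K^o)) (S : 'End(A)).
Hypotheses (phiF : faithful phi) (phiS : integral_antipode Delta phi S).
Hypothesis Sbij : bijective S.

Lemma dual_left_integral_faithful : faithful (dual_left_integral H phi).
Proof.
split=> [b b0|b' b0].
  apply: pairing_ext => a; have [T _ TK] := Sbij.
  by rewrite -(TK a) -(dual_left_integralM phiF phiS) b0 /pairing zero_lfunE.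
have [c e] := rmul_form_surj phiF b'; rewrite {}e in b0 *.
have -> : c = 0; last by rewrite linear0.
apply: (bij_inj Sbij); rewrite linear0; apply: (@pairing_sep _ _ _ _ H) => b.
by rewrite -(dual_left_integralM phiF phiS) b0 /pairing linear0.
Qed.

(** Slicing the coproduct of phi(c -) by [ev a] multiplies c by a on the right. The two sides of the
    relation then evaluate b at S a * S c and at S (c * a). *)
Lemma dual_integral_antipode : (forall a b, S (a * b) = S b * S a) ->
  integral_antipode DeltaB (dual_left_integral H phi) (transpose H S).
Proof.
move=> SM; apply/integral_antipodeE => f b b'.
have [a ->] := ev_surj f; have [c ->] := rmul_form_surj phiF b'.
have -> : (ev a \o transpose H S)%VF = ev (S a).
  by apply/lfunP => b2; rewrite comp_lfunE !evE pairing_transpose.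
have -> : slicel (ev a) (DeltaB (rmul_form H phi c)) = rmul_form H phi (c * a).
  by apply: pairing_ext => x; rewrite slicel_dual_coproduct !rmul_formE mulrA.
by rewrite !(dual_left_integralM phiF phiS) slicel_dual_coproduct SM.
Qed.

End DualCoalgebra.

(** Duality swaps axioms: multiplicativity of eps says that the coproduct of B preserves 1, and
    [Delta1] says that the counit of B is multiplicative. *)
Lemma dual_qhypergroup (K : fieldType) (A : falgType K)
    (Delta : 'Hom(A, tensor A A)) (eps : 'Hom(A, K^o)) (S : 'End(A))
    (H : finite_qhypergroup Delta eps S) (H' : counital_coproduct Delta eps) :
  finite_qhypergroup (dual_coproduct H') (ev H' 1) (transpose H' S).
Proof.
case: H => _ [phi [phiF phiS]] Delta1 eps1 epsM Sbij S1 SM.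
split.
- by split; [apply: dual_coassociative | apply: dual_counit].
- exists (dual_left_integral H' phi); split.
    exact: dual_left_integral_faithful phiF phiS Sbij.
  exact: dual_integral_antipode.
- by apply: tpairing_ext => a a'; rewrite dual_coproductE tpairingE !pairing1 epsM.
- by rewrite evE pairing1.
- by move=> b b'; rewrite !evE pairingM Delta1 tpairingE.
- exact: transpose_bij phiF phiS.
- exact: transpose1 phiF phiS.
- exact: transposeM phiF phiS.
Qed.

(** * Involutions on A and on its dual, and positivity *)

Lemma tstarD (C : numClosedFieldType) (A : falgType C) (star : A -> A)
    (x y : tensor A A) :
  tstar star (x + y) = tstar star x + tstar star y.
Proof.
rewrite /tstar -big_split; apply: eq_bigr => i _; rewrite -big_split.
by apply: eq_bigr => j _ /=; rewrite mxE rmorphD scalerDl.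
Qed.

Section StarDual.
Variables (C : numClosedFieldType) (A : falgType C) (star : A -> A).
Variables (Delta : 'Hom(A, tensor A A)) (eps : 'Hom(A, C^o)) (S : 'End(A)).
Hypothesis H : finite_star_qhypergroup star Delta eps S.
Variable H' : counital_coproduct Delta eps.
Local Notation B := (dual H').
Local Notation starB := (dual_star star S : B -> B).

Let sP : star_algebra star := fsqh_star H.

Lemma star1 : star 1 = 1.
Proof.
by rewrite -[LHS]mulr1 -[X in _ * X](starK sP) -(starM sP) mulr1 (starK sP).
Qed.

(** The part of [dual_star] that does not involve S. It preserves the order of products
    ([conj_formM]); the reversal in [dual_star] comes from [transpose S]. *)
Definition conj_form (b : B) : B :=
  linfun (fun a => (pairing (star a) b)^* : C^o).

Lemma conj_formE a (b : B) : pairing a (conj_form b) = (pairing (star a) b)^*.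
Proof.
rewrite {1}/pairing linfun_linE // => k a1 a2.
rewrite (starD sP) (starZ sP) pairingDl pairingZl.
by rewrite rmorphD rmorphM; congr (_ + _); rewrite /= conjCK.
Qed.

Lemma conj_formK : involutive conj_form.
Proof.
by move=> b; apply: pairing_ext => a; rewrite !conj_formE (starK sP) conjCK.
Qed.

Lemma dual_star_transpose (b : B) : starB b = transpose H' S (conj_form b).
Proof.
by apply: pairing_ext => a; rewrite dual_starE // pairing_transpose conj_formE.
Qed.

Lemma star_act (b : B) a : star (act b a) = act (conj_form b) (star a).
Proof.
rewrite /act (fsqh_coproduct_star H).
elim/tensor_ind: (Delta a) => [u v|x y IHx IHy].
  rewrite tstarE // !slicelE (starZ sP); congr (_ *: _).
  by rewrite -[RHS]/(pairing (star u) (conj_form b)) conj_formE (starK sP).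
by rewrite tstarD !slicelD (starD sP) IHx IHy.
Qed.

Lemma conj_formM (b b' : B) : conj_form (b * b') = conj_form b * conj_form b'.
Proof.
apply: pairing_ext => a; rewrite conj_formE -!pairing_act conj_formE.
by rewrite star_act conj_formK.
Qed.

Lemma invariant_conj (phi : 'Hom(A, C^o)) :
  left_invariant H' phi -> left_invariant H' (conj_form phi).
Proof.
move=> phiI b a; rewrite -!/(pairing _ (conj_form phi : B)) !conj_formE star_act.
by rewrite /pairing phiI rmorphM conj_formE star1; congr (_ * _); apply: conjCK.
Qed.


(** Conjugation preserves invariance, and invariant functionals are multiples of phi. *)
Lemma conj_invariant_proportional (phi : 'Hom(A, C^o)) : faithful phi ->
  integral_antipode Delta phi S ->
  exists k : C, forall a, phi (star a) = (k * phi a)^*.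
Proof.
move=> phiF phiS.
have [_ _ Delta1 _ _ _ S1 _] := fsqh_fqh H.
have phiI := integral_invariant (H := H') phiF phiS Delta1 S1.
have [k kE] := invariant_unique phiF phiS S1 (invariant_conj phiI).
by exists k => a; rewrite -kE -/(pairing _ (conj_form phi : B)) conj_formE conjCK.
Qed.

(** In A this reads S (star (S a)) = star a. Adjointness is used once before and once after applying
    star inside phi; the scalar k enters both sides alike. *)
Lemma transpose_conj_formK (b : B) :
  transpose H' S (conj_form (transpose H' S b)) = conj_form b.
Proof.
have [_ [phi [phiF phiS]] _ _ _ _ _ _] := fsqh_fqh H.
have [k phi_star] := conj_invariant_proportional phiF phiS.
apply: act_inj => c; apply: (faithful_injl phiF) => a.
rewrite (integral_adjoint phiS) -[a](starK sP) -[c](starK sP) -!star_act.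
by rewrite -!(starM sP) !phi_star (integral_adjoint phiS).
Qed.

Lemma dual_star_algebra : star_algebra starB.
Proof.
have [_ [phi [phiF phiS]] _ _ _ _ _ _] := fsqh_fqh H.
split=> [b b'|k b|b b'|b].
- by apply: pairing_ext => a; rewrite pairingDr !dual_starE // pairingDr rmorphD.
- by apply: pairing_ext => a; rewrite pairingZr !dual_starE // pairingZr rmorphM.
- by rewrite !dual_star_transpose conj_formM (transposeM phiF phiS).
- by rewrite !dual_star_transpose transpose_conj_formK conj_formK.
Qed.

Lemma tpairing_tstar a a' (y : tensor B B) :
  tpairing (a \ox a') (tstar starB y) =
  (tpairing (star (S a) \ox star (S a')) y)^*.
Proof.
elim/tensor_ind: y => [b b'|x y IHx IHy].
  by rewrite (tstarE dual_star_algebra) !tpairingE !dual_starE // rmorphM.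
by rewrite tstarD !tpairingDr IHx IHy rmorphD.
Qed.

Lemma dual_star_qhypergroup : finite_star_qhypergroup starB
  (dual_coproduct H') (ev H' 1) (transpose H' S).
Proof.
split; first exact: dual_qhypergroup H H'; first exact: dual_star_algebra.
move=> b; apply: tpairing_ext => a a'.
rewrite tpairing_tstar !dual_coproductE dual_starE //.
(* Both star and S reverse products, so a |-> star (S a) preserves them. *)
by rewrite (fqh_antipodeM H) (starM sP).
Qed.

(** A Cauchy-Schwarz argument: if phi 1 = 0, positivity at 1 + t c for all scalars t forces phi c =
    0 for every c, against faithfulness. *)
Lemma faithful_positive1 (phi : 'Hom(A, C^o)) :
  faithful phi -> positive star phi -> phi 1 != 0.
Proof.
move=> phiF phiP; apply/eqP=> phi1.
suff phi0 c : phi c = 0.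
  by have /eqP := phiF.1 1 (fun c => phi0 _); rewrite oner_eq0.
set p : C := phi c; set q : C := phi (star c); set s : C := phi (star c * c).
have s_ge0 : 0 <= s by apply: phiP.
have pos (t : C) : 0 <= t^* * q + t * p + t^* * t * s.
  have := phiP (1 + t *: c); rewrite (starD sP) (starZ sP) star1.
  rewrite mulrDl !mulrDr !mul1r mulr1 -!scalerAl -!scalerAr !linearD !linearZ.
  by rewrite /= phi1 add0r addrCA addrA scalerA.
have re (t : C) : t * q^* + t^* * p^* = t^* * q + t * p.
  have /CrealP : t^* * q + t * p \is Num.real.
    rewrite -[X in X \is _](addrK (t^* * t * s)).
    rewrite rpredB ?ger0_real ?pos //.
    by rewrite mulr_ge0 // mulrC mul_conjC_ge0.
  by rewrite rmorphD !rmorphM /= conjCK.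
(* The cases t = 'i and t = 1 of [re] give the difference and the sum of q^* and p^*. *)
have qE : q^* = p.
  have := re 'i; rewrite conjCi !mulNr -mulrBr [RHS]addrC -mulrBr.
  move/(mulfI (neq0Ci C)) => e2.
  have := re 1; rewrite conjC1 !mul1r => e1.
  apply: (@pmulrnI _ 2) => //=.
  have -> : q^* *+ 2 = (q^* + p^*) + (q^* - p^*) by ring.
  by rewrite e1 e2; ring.
have pq_ge0 : 0 <= p * q by rewrite -qE mulrC mul_conjC_ge0.
(* For s > 0 the quadratic at t = - r q is least when r = 1 / s; the added 1 covers s = 0 and still
   gives r s < 2. *)
set r : C := (s + 1)^-1.
have r_gt0 : 0 < r by rewrite invr_gt0 ltr_wpDl.
have r_real : r^* = r by apply/CrealP/gtr0_real.
have := pos (- r * q).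
rewrite rmorphM rmorphN /= r_real qE.
have -> : - r * p * q + - r * q * p + - r * p * (- r * q) * s =
  r * (p * q) * (r * s - 2) by ring.
have rs_lt : r * s - 2 < 0.
  rewrite subr_lt0 mulrC ltr_pdivrMr ?ltr_wpDl //.
  by rewrite mulrDr mulr1 mulr_natl mulr2n -addrA ltrDl ltr_wpDl // ltr0n.
rewrite (nmulr_lge0 _ rs_lt) (pmulr_rle0 _ r_gt0) => pq_le0.
have /eqP : p * q = 0 by apply: le_anti; rewrite pq_le0.
by rewrite -qE mulrC mul_conjC_eq0 => /eqP ->; rewrite conjC0.
Qed.

(* The map [S'] attached to phi need not be S: on functions on a group, the   *)
(* Haar sum twisted by a character is also a left integral. Positivity gives   *)
(* phi 1 != 0, which forces S' 1 = 1 and thus invariance of phi.               *)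
Lemma dual_integral_positive (phi : 'Hom(A, C^o)) : left_integral Delta phi ->
  faithful phi -> positive star phi -> positive starB (dual_integral H' phi).
Proof.
have [_ [phi0 [phi0F phi0S]] Delta1 _ _ _ S1 _] := fsqh_fqh H.
move=> [S' phiS'] phiF phiP b.
have S'1 := integral_antipode1 phiS' Delta1 (faithful_positive1 phiF phiP).
have phiI := integral_invariant (H := H') phiF phiS' Delta1 S'1.
have [k phiE] := invariant_unique phi0F phi0S S1 phiI.
(* The antipode relation is homogeneous in the functional, so it passes from phi0 to its multiple
   phi. *)
have phiS : integral_antipode Delta phi S.
  apply/integral_antipodeE => f a c; rewrite !phiE; congr (_ * _).
  exact: (integral_antipodeE _ _ _).1.
have [c ->] := lmul_form_surj b phiF.
rewrite dual_star_transpose (dual_integralM phiF phiS) conj_formE lmul_formE.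
by rewrite conjC_ge0.
Qed.

End StarDual.

Theorem theorem3p13 (R : realType) (A : falgType R[i]) (star : A -> A)
    (Delta : 'Hom(A, tensor A A)) (eps : 'Hom(A, R[i]^o)) (S : 'End(A))
    (H : finite_star_qhypergroup star Delta eps S) :
  let B := dual (fqh_coproduct H) in
  let starB : B -> B := dual_star star S in
  [/\ star_algebra starB,
      (exists (epsB : 'Hom(B, R[i]^o)) (SB : 'End(B)),
        finite_star_qhypergroup starB
          (dual_coproduct (fqh_coproduct H)) epsB SB) &
      (forall phi : 'Hom(A, R[i]^o),
        left_integral Delta phi -> faithful phi -> positive star phi ->
        positive starB (dual_integral (fqh_coproduct H) phi))].
Proof.
split; first exact: dual_star_algebra H _.
  exists (ev (fqh_coproduct H) 1), (transpose (fqh_coproduct H) S).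
  exact: dual_star_qhypergroup H _.
by move=> phi; apply: dual_integral_positive H _ phi.
Qed.
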